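(* Let $\lambda$ be a nonzero real number. For every integer $n\ge 0$, as polynomials in $x$, $$B_{n,\lambda}^{L}(x)=\sum_{k=0}^{n}L(n,k)(x)_{k,\lambda}.$$
   Context: For $0\ne\lambda\in\mathbb{R}$, put $(x)_{0,\lambda}=1$ and $(x)_{n,\lambda}=x(x-\lambda)\cdots(x-(n-1)\lambda)$ for $n\ge 1$; the degenerate exponential function is $e_\lambda^x(t)=(1+\lambda t)^{x/\lambda}=\sum_{n=0}^\infty (x)_{n,\lambda}\frac{t^n}{n!}$. The degenerate Lah-Bell polynomials $B_{n,\lambda}^L(x)$ are defined by $e_\lambda^x\left(\frac{1}{1-t}-1\right)=\sum_{n=0}^\infty B_{n,\lambda}^L(x)\frac{t^n}{n!}$ (formal power series in $t$). For integers $n,k\ge 0$, the unsigned Lah number $L(n,k)$ is the number of ways a set of $n$ elements can be partitioned into $k$ nonempty linearly ordered subsets (so $L(0,0)=1$, $L(n,0)=0$ for $n\ge 1$, $L(n,k)=0$ for $k>n$, and $L(n,k)=\binom{n-1}{k-1}\frac{n!}{k!}$ for $n\ge k\ge 1$). *)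

(* Defs.v *)
From HB Require Import structures.
From mathcomp Require Import all_boot all_order all_algebra.
From mathcomp Require Import reals.

Set Implicit Arguments.
Unset Strict Implicit.
Unset Printing Implicit Defensive.

Import GRing.Theory.
Local Open Scope ring_scope.

(* A formal power series sum_n f_n t^n is its sequence of coefficients f.     *)
(* Below the coefficient ring is {poly R}; its indeterminate 'X is the        *)
(* variable x of the statement, while the series variable t is fps_t.         *)
Definition fps (A : Type) := nat -> A.

Definition fps_cst (A : comUnitRingType) (c : A) : fps A :=
  fun n => if n == 0%N then c else 0.

Definition fps_t (A : comUnitRingType) : fps A := fun n => (n == 1%N)%:R.

Definition fps_sub (A : comUnitRingType) (f g : fps A) : fps A :=
  fun n => f n - g n.

Definition fps_scale (A : comUnitRingType) (c : A) (f : fps A) : fps A :=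
  fun n => c * f n.

Definition fps_mul (A : comUnitRingType) (f g : fps A) : fps A :=
  fun n => \sum_(i < n.+1) f i * g (n - i)%N.

Definition fps_exp (A : comUnitRingType) (f : fps A) (k : nat) : fps A :=
  iter k (fps_mul f) (fps_cst 1).

(* The composite f(g(t)), meaningful when g has constant term 0: then         *)
(* g(t)^k contributes nothing to the coefficient of t^n for k > n.            *)
Definition fps_comp (A : comUnitRingType) (f g : fps A) : fps A :=
  fun n => \sum_(k < n.+1) f k * fps_exp g k n.

(* Coefficients 0, ..., n of 1 / f, solving f * (1 / f) = 1 degree by degree; *)
(* meaningful when the constant term of f is a unit (see fps_mulV).           *)
Fixpoint fps_inv_coefs (A : comUnitRingType) (f : fps A) (n : nat) : seq A :=
  if n is m.+1 then
    let s := fps_inv_coefs f m in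
    rcons s (- (f 0%N)^-1 * \sum_(i < m.+1) f (m.+1 - i)%N * s`_i)
  else [:: (f 0%N)^-1].

Definition fps_inv (A : comUnitRingType) (f : fps A) : fps A :=
  fun n => (fps_inv_coefs f n)`_n.

Lemma size_fps_inv_coefs (A : comUnitRingType) (f : fps A) n :
  size (fps_inv_coefs f n) = n.+1.
Proof. by elim: n => //= n IHn; rewrite size_rcons IHn. Qed.

Lemma nth_fps_inv_coefs (A : comUnitRingType) (f : fps A) n i :
  (i <= n)%N -> (fps_inv_coefs f n)`_i = fps_inv f i.
Proof.
elim: n => [|n IHn]; first by rewrite leqn0 => /eqP->.
rewrite leq_eqVlt => /orP[/eqP->//|lt_in].
by rewrite /= nth_rcons size_fps_inv_coefs lt_in IHn.
Qed.

Lemma fps_mulV (A : comUnitRingType) (f : fps A) :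
  f 0%N \is a GRing.unit -> fps_mul f (fps_inv f) =1 fps_cst 1.
Proof.
move=> Uf [|n]; first by rewrite /fps_mul big_ord1 /fps_inv /= mulrV.
rewrite /fps_mul big_ord_recl subn0 [fps_inv f n.+1]/fps_inv /=.
rewrite nth_rcons size_fps_inv_coefs ltnn eqxx mulrA mulrN mulrV // mulN1r.
rewrite [X in _ + X](reindex_inj rev_ord_inj) /=.
rewrite [X in _ + X](eq_bigr (fun i : 'I_n.+1 =>
  f (n.+1 - i)%N * (fps_inv_coefs f n)`_i)) ?addNr // => i _.
have le_in : (i <= n)%N by rewrite -ltnS.
by rewrite nth_fps_inv_coefs // /bump add1n !subSS subKn // subSn.
Qed.

(* Binomial series (1 + t)^a = sum_n a (a - 1) ... (a - n + 1) / n! t^n.      *)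
Definition fps_binom (R : realType) (a : {poly R}) : fps {poly R} :=
  fun n => (n`!%:R)^-1 *: \prod_(i < n) (a - i%:R).

(* e_lambda^x(t) = (1 + lambda t)^(x / lambda).                               *)
Definition degexp (R : realType) (lambda : R) : fps {poly R} :=
  fps_comp (fps_binom (lambda^-1 *: 'X))
           (fps_scale lambda%:P (fps_t {poly R})).

(* (x)_{n,lambda} = x (x - lambda) ... (x - (n - 1) lambda), in R[x].         *)
Definition dfall (R : realType) (lambda : R) (n : nat) : {poly R} :=
  \prod_(i < n) ('X - (i%:R * lambda)%:P).

Lemma fps_exp_scale_t (A : comUnitRingType) (c : A) k n :
  fps_exp (fps_scale c (fps_t A)) k n = if n == k then c ^+ k else 0.
Proof.
elim: k n => [|k IHk] n; first by rewrite /fps_exp /= /fps_cst expr0.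
rewrite [LHS]/(fps_mul _ (fps_exp _ k) n) /fps_mul.
under eq_bigr do rewrite IHk /fps_scale /fps_t.
case: n => [|n]; first by rewrite big_ord1 /= mulr0 mul0r.
rewrite 2!big_ord_recl /= mulr0 mul0r add0r mulr1 subSS subn0.
rewrite big1 ?addr0 => [|i _]; last by rewrite mul0r.
by rewrite eqSS; case: eqP => _; rewrite ?mulr0 // exprS.
Qed.

(* The expansion e_lambda^x(t) = sum_n (x)_{n,lambda} t^n / n!.               *)
Lemma degexpE (R : realType) (lambda : R) : lambda != 0 ->
  forall n, degexp lambda n = (n`!%:R)^-1 *: dfall lambda n.
Proof.
move=> nz_l n; rewrite /degexp /fps_comp big_ord_recr /= big1 ?add0r; last first.
  by move=> i _; rewrite fps_exp_scale_t gtn_eqF ?mulr0.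
rewrite fps_exp_scale_t eqxx /fps_binom -scalerAl; congr (_ *: _).
rewrite -[X in _ ^+ X]card_ord -prodr_const -big_split /=.
apply: eq_bigr => i _.
rewrite mulrBl -mul_polyC mulrAC -polyCM mulVf // mul1r.
by rewrite polyCM -polyC_natr.
Qed.

(* B_n(x) is n! times the coefficient of t^n in e_lambda^x(1 / (1 - t) - 1).  *)
Definition lahbell (R : realType) (lambda : R) (n : nat) : {poly R} :=
  let one := fps_cst (1 : {poly R}) in
  let u := fps_sub (fps_inv (fps_sub one (fps_t {poly R}))) one in
  n`!%:R *: fps_comp (degexp lambda) u n.

(* r, as a set of pairs, is a (non-strict) linear order on B.                 *)
Definition linear_order_on (T : finType) (B : {set T}) (r : {set T * T}) :=
  [&& r \subset setX B B,
      [forall x in B, (x, x) \in r],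
      [forall x, forall y, ((x, y) \in r) && ((y, x) \in r) ==> (x == y)],
      [forall x, forall y, forall z,
         ((x, y) \in r) && ((y, z) \in r) ==> ((x, z) \in r)] &
      [forall x in B, forall y in B, ((x, y) \in r) || ((y, x) \in r)]].

(* The partitions of A into k nonempty linearly ordered subsets: sets Q of k  *)
(* pairs (B, r), with r a linear order on B, whose first components are       *)
(* pairwise distinct and form a partition of A.                               *)
Definition lah_partitions (T : finType) (A : {set T}) (k : nat) :
    {set {set {set T} * {set T * T}}} :=
  [set Q : {set {set T} * {set T * T}} |
    [&& #|Q| == k,
        [forall b in Q, linear_order_on b.1 b.2],
        dinjectiveb (fun b : {set T} * {set T * T} => b.1) (mem Q) &
        partition [set b.1 | b in Q] A]].

(* Unsigned Lah number L(n,k).                                                *)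
Definition lah (n k : nat) : nat := #|lah_partitions [set: 'I_n] k|.

(* Main.v *)
Require Import Defs.
From mathcomp Require Import all_boot all_order all_algebra.
From mathcomp Require Import reals.
Local Open Scope ring_scope.
Import GRing.Theory.

Set Implicit Arguments.
Unset Strict Implicit.
Unset Printing Implicit Defensive.

(** The coefficient of t^n in u^k, for u = 1/(1 - t) - 1 = t + t^2 + ..., is
k! L(n,k) / n!: a k-tuple of disjoint nonempty ordered blocks filling an n-set
is a product of k structures, each of exponential generating function u, since
a set of m > 0 elements has m! linear orders. Substituting this in
e_lambda^x(u) = sum_k (x)_{k,lambda} u^k / k! gives the theorem.

The coefficient identity is fps_exp_card_lah, proved by induction on k.
Counting in two ways the pairs formed by a partition Q of A into k+1 ordered
blocks and one of these blocks yields, in mul_card_lah_partitions,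
  (k+1) L(A,k+1) = sum over nonempty B included in A of |B|! L(A - B,k),
and this is the Cauchy product u^(k+1) = u * u^k once the subsets B are grouped
by cardinality. Marking an arbitrary block, rather than the block of a chosen
element, is what makes the recurrence have the shape of a plain product. *)

(** * Linear orders on a finite set *)

Lemma linear_order_onP (T : finType) (B : {set T}) (r : {set T * T}) :
  reflect
    [/\ forall x y, (x, y) \in r -> x \in B /\ y \in B,
        {in B, forall x, (x, x) \in r},
        forall x y, (x, y) \in r -> (y, x) \in r -> x = y,
        forall x y z, (x, y) \in r -> (y, z) \in r -> (x, z) \in r &
        {in B &, forall x y, ((x, y) \in r) || ((y, x) \in r)}]
    (linear_order_on B r).
Proof.
apply: (iffP and5P) => [[rB /forall_inP rr ra rt /forall_inP rtot]|].
  split=> // [x y rxy|x y rxy ryx|x y z rxy ryz|x y xB yB].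
  - by have := subsetP rB _ rxy; rewrite inE => /andP[].
  - by move/forallP: ra => /(_ x)/forallP/(_ y); rewrite rxy ryx => /eqP.
  - move/forallP: rt => /(_ x)/forallP/(_ y)/forallP/(_ z).
    by rewrite rxy ryz.
  - by move/forall_inP: (rtot x xB); apply.
case=> rB rr ra rt rtot; split.
- by apply/subsetP=> -[x y] /rB[xB yB]; rewrite inE /= xB yB.
- exact/forall_inP.
- apply/forallP=> x; apply/forallP=> y; apply/implyP=> /andP[rxy ryx].
  exact/eqP/ra.
- apply/forallP=> x; apply/forallP=> y; apply/forallP=> z.
  by apply/implyP=> /andP[]; apply: rt.
- by apply/forall_inP=> x xB; apply/forall_inP=> y yB; apply: rtot.
Qed.

Definition order_of_seq (T : finType) (s : seq T) : {set T * T} :=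
  [set p | [&& p.1 \in s, p.2 \in s & (index p.1 s <= index p.2 s)%N]].

Lemma order_of_seq_linear (T : finType) (B : {set T}) (s : seq T) :
  s =i B -> linear_order_on B (order_of_seq s).
Proof.
move=> sB; apply/linear_order_onP; split.
- by move=> x y; rewrite inE /= !sB => /and3P[].
- by move=> x xB; rewrite inE /= sB xB leqnn.
- move=> x y; rewrite !inE /= => /and3P[xs ys lexy] /and3P[_ _ leyx].
  by rewrite -(nth_index x xs) -(nth_index x ys); congr nth; apply/anti_leq/andP.
- move=> x y z; rewrite !inE /= => /and3P[-> _ lexy] /and3P[_ -> leyz].
  exact: leq_trans leyz.
- by move=> x y xB yB; rewrite !inE /= !sB xB yB /= leq_total.
Qed.

(** Both sequences are sorted for the order they induce, and an antisymmetric
order has only one sorted arrangement of given elements. *)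
Lemma order_of_seq_inj (T : finType) (s1 s2 : seq T) :
  uniq s1 -> perm_eq s1 s2 -> order_of_seq s1 = order_of_seq s2 -> s1 = s2.
Proof.
move=> Us1 s12 eq_r.
have Us2 : uniq s2 by rewrite -(perm_uniq s12).
pose le x y := (x, y) \in order_of_seq s1.
have [_ _ ra rt _] := elimT (linear_order_onP _ _)
  (@order_of_seq_linear _ [set x in s1] s1 (fun x => esym (in_set _ x))).
have sorted_le s : uniq s -> sorted (fun x y => (x, y) \in order_of_seq s) s.
  move=> Us; case Ds: s => [|x0 s'] //; rewrite -Ds.
  apply/(sortedP x0) => i lt_i.
  rewrite inE; apply/and3P; split; rewrite /= ?mem_nth //; first exact: ltnW.
  by rewrite !index_uniq // ltnW.
apply: (@sorted_eq_in _ le) => //.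
- by move=> y x z _ _ _; apply: rt.
- by move=> x y _ _ /andP[]; apply: ra.
- exact: sorted_le.
- by rewrite /le eq_r; apply: sorted_le.
Qed.

Lemma order_of_seq_sort (T : finType) (B : {set T}) (r : {set T * T}) :
  linear_order_on B r ->
  order_of_seq (sort (fun x y => (x, y) \in r) (enum B)) = r.
Proof.
case/linear_order_onP=> rB rr ra rt rtot; set le := fun x y => _.
set s := sort _ _.
have sB : s =i B by move=> x; rewrite mem_sort mem_enum.
have s_sorted : sorted le s.
  by apply: (@sort_sorted_in _ (mem B)) => //; apply/allP=> x; rewrite mem_enum.
have le_index : {in s &, forall x y, (index x s <= index y s)%N -> le x y}.
  apply: sorted_leq_index_in => //; last by move=> x; rewrite sB; apply: rr.
  by move=> y x z _ _ _; apply: rt.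
apply/setP=> -[x y]; rewrite inE /=; apply/and3P/idP => [[xs ys]|rxy].
  exact: le_index.
have [xB yB] := rB _ _ rxy; rewrite !sB; split=> //.
case: leqP => // lt_yx.
have ryx : le y x by apply: le_index; rewrite ?sB // ltnW.
by rewrite (ra _ _ rxy ryx) ltnn in lt_yx.
Qed.

(** [order_of_seq] maps the arrangements of the elements of B bijectively onto
the linear orders on B; sorting B is the inverse map. *)
Lemma card_linear_orders (T : finType) (B : {set T}) :
  #|[set r | linear_order_on B r]| = #|B|`!.
Proof.
have mem_perms s : s \in permutations (enum B) -> s =i B.
  by rewrite mem_permutations => /perm_mem sB x; rewrite sB mem_enum.
rewrite [in RHS]cardE -size_permutations ?enum_uniq //.
rewrite -(size_map (@order_of_seq T)).
rewrite -(card_uniqP _); last first.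
  rewrite map_inj_in_uniq ?permutations_uniq // => s1 s2.
  rewrite !mem_permutations => s1B s2B; apply: order_of_seq_inj.
    by rewrite (perm_uniq s1B) enum_uniq.
  by rewrite (perm_trans s1B) // perm_sym.
apply: eq_card => r; rewrite inE; apply/idP/mapP => [r_lin|[s sP ->]].
  exists (sort (fun x y => (x, y) \in r) (enum B)).
    by rewrite mem_permutations perm_sort.
  by rewrite order_of_seq_sort.
exact/order_of_seq_linear/mem_perms.
Qed.

(** * Removing a marked block from a partition into ordered blocks *)

Lemma lah_partitionsP (T : finType) (A : {set T}) (k : nat)
    (Q : {set {set T} * {set T * T}}) :
  reflect
    [/\ #|Q| = k, {in Q, forall b, linear_order_on b.1 b.2},
        {in Q &, injective (fun b : {set T} * {set T * T} => b.1)} &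
        partition [set b.1 | b in Q] A]
    (Q \in lah_partitions A k).
Proof.
rewrite inE; apply: (iffP and4P) => [[/eqP ? /forall_inP ? /dinjectiveP ? ?]|].
  by [].
by case=> /eqP ? ? ? ?; split=> //; [apply/forall_inP | apply/dinjectiveP].
Qed.

Definition lah_block (T : finType) (A : {set T}) (b : {set T} * {set T * T}) :=
  [&& b.1 \subset A, b.1 != set0 & linear_order_on b.1 b.2].

Lemma lah_partitions_block (T : finType) (A : {set T}) (k : nat) Q b :
  Q \in lah_partitions A k -> b \in Q -> lah_block A b.
Proof.
case/lah_partitionsP=> _ Qlin _ Qpart bQ.
have bP : b.1 \in [set b.1 | b in Q] by apply: imset_f.
rewrite /lah_block Qlin // andbT (partitionS Qpart bP) /=.
by apply: contraTneq bP => ->; case/and3P: Qpart.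
Qed.

Lemma lah_partitionsD1 (T : finType) (A : {set T}) (k : nat) Q b :
  Q \in lah_partitions A k.+1 -> b \in Q ->
  Q :\ b \in lah_partitions (A :\: b.1) k.
Proof.
case/lah_partitionsP=> cardQ Qlin Qinj Qpart bQ; apply/lah_partitionsP; split.
- by apply/eqP; rewrite -eqSS -cardQ (cardsD1 b Q) bQ.
- by move=> c /setD1P[_]; apply: Qlin.
- by move=> c d /setD1P[_ cQ] /setD1P[_ dQ]; apply: Qinj.
have ->: [set c.1 | c in Q :\ b] = [set c.1 | c in Q] :\ b.1.
  apply/setP=> B; rewrite in_setD1; apply/imsetP/andP.
    case=> c /setD1P[cb cQ] ->; split; last exact: imset_f.
    by apply: contraNneq cb => /Qinj->.
  case=> Bb /imsetP[c cQ eqB]; exists c => //; rewrite !inE cQ andbT.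
  by apply: contraNneq Bb => <-; rewrite eqB.
by apply: partitionD1 => //; apply: imset_f.
Qed.

(** A block of a partition of A :\: b.1 is nonempty and disjoint from b.1. Hence
adding b to Q adds an element and keeps the supports distinct. *)
Lemma lah_partitions_notin (T : finType) (A : {set T}) (k : nat) Q b :
  lah_block A b -> Q \in lah_partitions (A :\: b.1) k ->
  {in Q, forall c, c.1 != b.1}.
Proof.
case/and3P=> _ nz_b _ QA c cQ.
have /and3P[cA nz_c _] := lah_partitions_block QA cQ.
apply: contra_neq nz_b => eq_cb; apply/eqP; rewrite -subset0.
by rewrite -[set0](setICr b.1) subsetI subxx -{1}eq_cb (subset_trans cA) // subsetDr.
Qed.

Lemma lah_partitionsU1 (T : finType) (A : {set T}) (k : nat) Q b :
  lah_block A b -> Q \in lah_partitions (A :\: b.1) k ->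
  b |: Q \in lah_partitions A k.+1.
Proof.
move=> bA QA; have Qb := lah_partitions_notin bA QA.
case/and3P: bA => sbA nz_b b_lin.
case/lah_partitionsP: QA => cardQ Qlin Qinj Qpart.
apply/lah_partitionsP; split.
- rewrite cardsU1 cardQ; case: (boolP (b \in Q)) => // /Qb.
  by rewrite eqxx.
- by move=> c /setU1P[->|] //; apply: Qlin.
- move=> c d /setU1P[->|cQ] /setU1P[->|dQ] //=; last exact: Qinj.
    by move=> eq_bd; have := Qb _ dQ; rewrite eq_bd eqxx.
  by move=> eq_cb; have := Qb _ cQ; rewrite eq_cb eqxx.
rewrite imsetU1 -(setID A b.1) (setIidPr sbA) partitionU1 //.
by rewrite disjoint_sym disjoints_subset subsetDr.
Qed.

(** Removing b from Q is a bijection onto the partitions of what b leaves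
uncovered; both sides vanish when b cannot be a block. *)
Lemma card_lah_partitions_mem (T : finType) (A : {set T}) (k : nat) b :
  #|[set Q in lah_partitions A k.+1 | b \in Q]|
  = (lah_block A b * #|lah_partitions (A :\: b.1) k|)%N.
Proof.
have [bA | bA] := boolP (lah_block A b); last first.
  rewrite mul0n; apply: eq_card0 => Q; rewrite inE; apply: contraNF bA.
  by case/andP; apply: lah_partitions_block.
rewrite mul1n -[RHS](@card_in_imset _ _ (setU [set b])) => [|Q1 Q2 Q1A Q2A eqQ].
  apply: eq_card => Q; apply/setIdP/imsetP => [[QA bQ]|[Q' QA ->]].
    by exists (Q :\ b); [apply: lah_partitionsD1 | rewrite setD1K].
  by rewrite setU11 lah_partitionsU1.
have notin Q : Q \in lah_partitions (A :\: b.1) k -> b \notin Q.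
  move=> QA; apply/negP=> bQ.
  by have := lah_partitions_notin bA QA bQ; rewrite eqxx.
by rewrite -(setU1K (notin _ Q1A)) eqQ setU1K ?notin.
Qed.

(** Both sides count the pairs of a partition and one of its blocks. On the
right the marked block is chosen first: its support B, then one of the |B|!
linear orders on B, then the other k blocks. *)
Lemma mul_card_lah_partitions (T : finType) (A : {set T}) (k : nat) :
  (k.+1 * #|lah_partitions A k.+1|
   = \sum_(B : {set T} | (B \subset A) && (B != set0))
       #|B|`! * #|lah_partitions (A :\: B) k|)%N.
Proof.
have ->: (k.+1 * #|lah_partitions A k.+1| =
    \sum_(Q in lah_partitions A k.+1) \sum_(b in Q) 1)%N.
  rewrite mulnC -sum_nat_const; apply: eq_bigr => Q /lah_partitionsP[<- _ _ _].
  by rewrite sum1_card.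
rewrite (exchange_big_dep xpredT) //=.
rewrite (eq_bigr (fun b : {set T} * {set T * T} =>
   lah_block A b * #|lah_partitions (A :\: b.1) k|))%N; last first.
  move=> b _; rewrite -card_lah_partitions_mem sum1dep_card.
  by apply: eq_card => Q; rewrite !inE.
rewrite -(pair_bigA _ (fun B r =>
   lah_block A (B, r) * #|lah_partitions (A :\: B) k|))%N /=.
rewrite [RHS]big_mkcond; apply: eq_bigr => B _.
rewrite -big_distrl /= /lah_block /=; case: ifP => [/andP[-> ->]|sB].
  congr (_ * _)%N; rewrite -card_linear_orders -sum1dep_card [RHS]big_mkcond /=.
  by apply: eq_bigr => r _; case: linear_order_on.
by rewrite big1 ?mul0n // => r _; rewrite andbA sB.
Qed.

Lemma card_lah_partitions0 (T : finType) (A : {set T}) :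
  #|lah_partitions A 0| = (A == set0).
Proof.
have part0 : partition (@imset _ _ fst (mem (set0 : {set {set T} * {set T * T}}))) A = (A == set0).
  by rewrite imset0 /partition /cover big_set0 inE /trivIset /cover !big_set0
     cards0 eqxx !andbT eq_sym.
have [A0 | A0] := boolP (A == set0).
  apply/eqP/cards1P; exists set0; apply/setP=> Q; rewrite in_set1.
  apply/lah_partitionsP/eqP => [[/cards0_eq]|->] //; rewrite cards0.
  by split=> // [b|b c|]; rewrite ?inE // part0.
apply: eq_card0 => Q; apply/negP=> /lah_partitionsP[/cards0_eq-> _ _].
by rewrite part0 (negPf A0).
Qed.

(** * Generating functions *)

Lemma sum_subsets_card (V : nmodType) (T : finType) (A : {set T})
    (F : nat -> V) :
  \sum_(B : {set T} | B \subset A) F #|B|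
  = \sum_(j < #|A|.+1) F j *+ 'C(#|A|, j).
Proof.
rewrite (partition_big (fun B : {set T} => inord #|B| : 'I_#|A|.+1) xpredT) //=.
apply: eq_bigr => j _; rewrite -cards_draws -sumr_const.
apply: eq_big => [B | B /andP[BA /eqP<-]]; last first.
  by rewrite inordK // ltnS subset_leq_card.
rewrite inE; apply: andb_id2l => BA.
by rewrite -val_eqE /= inordK // ltnS subset_leq_card.
Qed.

(** In the recurrence a subset of size j contributes j! (|S| - j)! times a
function of j, and there are 'C(|S|, j) such subsets: the weights multiply to
|S|! for every j, which leaves the Cauchy product of u and u^k. *)
Lemma fps_exp_card_lah (A : comUnitRingType) (u : fps A) :
    (forall m, u m = (0 < m)%:R) ->
  forall (T : finType) (S : {set T}) (k : nat),
  (k`! * #|lah_partitions S k|)%:R = #|S|`!%:R * fps_exp u k #|S|.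
Proof.
move=> uE T S k; elim: k S => [|k IHk] S.
  rewrite fact0 mul1n card_lah_partitions0 /fps_exp /fps_cst /= cards_eq0.
  by case: eqP => [->|_]; rewrite ?mulr0 // cards0 mulr1.
rewrite factS -mulnA [(k`! * _)%N]mulnC mulnA mul_card_lah_partitions.
rewrite mulnC big_distrr /= natr_sum.
transitivity (\sum_(B : {set T} | B \subset S)
    (#|B|`! * (#|S| - #|B|)`!)%:R * (u #|B| * fps_exp u k (#|S| - #|B|)%N)).
  rewrite big_mkcondr; apply: eq_bigr => B BS; rewrite uE card_gt0.
  case: eqP => _ /=; first by rewrite mulr0n mul0r mulr0.
  (* k! L(S - B,k) is the value of the induction hypothesis at S - B. *)
  by rewrite mulr1n mul1r mulnCA natrM IHk cardsD (setIidPr BS) mulrA -natrM.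
rewrite (sum_subsets_card S (fun j =>
    (j`! * (#|S| - j)`!)%:R * (u j * fps_exp u k (#|S| - j)%N))).
rewrite /fps_mul mulr_sumr.
apply: eq_bigr => j _; rewrite -mulrnAl -mulrnA mulnC bin_fact //.
by rewrite -ltnS.
Qed.

(** In the recurrence that defines the inverse only the coefficient -1 of t
contributes, so that each coefficient of 1/(1 - t) repeats the previous one. *)
Lemma fps_inv_1subt (A : comUnitRingType) (n : nat) :
  fps_inv (fps_sub (fps_cst 1) (fps_t A)) n = 1.
Proof.
set f := fps_sub _ _; pose s := fps_inv_coefs f.
suff sE m : s m = nseq m.+1 1 by rewrite /fps_inv -/(s n) sE nth_nseq ltnSn.
have f0 : f 0%N = 1 by rewrite /f /fps_sub /fps_cst /fps_t subr0.
elim: m => [|m IHm]; first by rewrite /s /= f0 invr1.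
have <-: rcons (nseq m.+1 1) 1 = nseq m.+2 1 :> seq A.
  by rewrite -cats1 -[[:: 1]]/(nseq 1 1) -nseqD addn1.
rewrite /s [LHS]/= -/(s m) IHm f0 invr1; congr rcons.
rewrite (eq_bigr (fun i : 'I_m.+1 => f (m.+1 - i)%N)) => [|i _]; last first.
  by rewrite nth_nseq ltn_ord mulr1.
rewrite big_ord_recr /= big1 ?add0r => [|i _].
  by rewrite subSnn /f /fps_sub /fps_cst /fps_t /= sub0r mulrNN mulr1.
rewrite /f /fps_sub /fps_cst /fps_t subn_eq0 leqNgt ltnS ltnW //=.
rewrite subSn ?(ltnW (ltn_ord i)) // eqSS subn_eq0 leqNgt ltn_ord /=.
by rewrite subr0.
Qed.

Theorem mainTheorem13 (R : realType) (lambda : R) (lambda_neq0 : lambda != 0)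
    (n : nat) :
  lahbell lambda n = \sum_(k < n.+1) (lah n k)%:R *: dfall lambda k.
Proof.
rewrite /lahbell; set u := fps_sub (fps_inv _) _.
have uE m : u m = (0 < m)%:R.
  by rewrite /u {1}/fps_sub fps_inv_1subt /fps_cst lt0n; case: m => [|m];
     rewrite ?subrr ?subr0.
have natZ (m : nat) (p : {poly R}) : m%:R *: p = m%:R * p.
  by rewrite scaler_nat mulr_natl.
rewrite /fps_comp scaler_sumr; apply: eq_bigr => k _.
rewrite degexpE // -scalerAl scalerA mulrC -scalerA scalerAr (natZ n`!).
have := fps_exp_card_lah uE [set: 'I_n] k.
rewrite cardsT card_ord -/(lah n k) => <-.
rewrite mulrC -natZ scalerA natrM mulrA mulVf ?mul1r //.
by rewrite Num.Theory.pnatr_eq0 -lt0n fact_gt0.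
Qed.
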